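(* Let $m_a$ and $m_b$ be two functions from the class $\mathcal{M}$. Then the fractional flow function $$f(s) = \frac{m_a(s)}{m_a(s)+m_b(1-s)}, \qquad s\in[0,1],$$ is S-shaped, that is, it has a unique inflection point in $(0,1)$: there exists exactly one $s^*\in(0,1)$ such that $f''(s^* )=0$.
   Context: $\mathcal{M}$ denotes the set of functions $m\in C^2[0,1]$ such that: (C1) $m(s)>0$ for $s>0$ and $m(0)=0$; (C2) $m'(s)>0$ for $s>0$ and $m'(0)=0$; (C3) $m''(s)>0$ for $s>0$; (C4) the function $\frac{m''}{m'}$ is decreasing on $(0,1)$. ''Decreasing'' means strictly decreasing. An inflection point of $f$ is a point $s\in(0,1)$ at which $f''(s)=0$. *)

(* Defs.v *)
From Stdlib Require Import Reals.
From Coquelicot Require Import Coquelicot.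
Open Scope R_scope.

Definition I01 (s : R) : Prop := 0 <= s <= 1.

(* [D_in] and [continue_in] are relative to [I01], so the derivatives are
   one-sided at 0 and 1 and the values of [m] outside [0,1] play no role.
   On [0,1] the functions [m1] = m' and [m2] = m'' are determined by [m]. *)
Definition C2_01 (m m1 m2 : R -> R) : Prop :=
  forall s, I01 s ->
    D_in m m1 I01 s /\ D_in m1 m2 I01 s /\ continue_in m2 I01 s.

Definition class_M (m : R -> R) : Prop :=
  exists m1 m2 : R -> R,
    C2_01 m m1 m2 /\
    ((forall s, 0 < s <= 1 -> 0 < m s) /\ m 0 = 0) /\
    ((forall s, 0 < s <= 1 -> 0 < m1 s) /\ m1 0 = 0) /\
    (forall s, 0 < s <= 1 -> 0 < m2 s) /\
    (forall s t, 0 < s -> s < t -> t < 1 -> m2 t / m1 t < m2 s / m1 s).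

Definition fractional_flow (ma mb : R -> R) (s : R) : R :=
  ma s / (ma s + mb (1 - s)).

Definition inflection_point (f : R -> R) (s : R) : Prop :=
  0 < s < 1 /\ is_derive_n f 2 s 0.

Definition S_shaped (f : R -> R) : Prop :=
  exists! s, inflection_point f s.

(* Main.v *)
(** Write [a = m_a(s)], [b = m_b(1-s)], [p = m_a'(s)], [q = m_b'(1-s)],
    [A = m_a''/m_a' (s)] and [B = m_b''/m_b' (1-s)].  Then
    [f' = (p b + a q) / (a + b)^2] vanishes at 0 and 1, so Rolle's theorem
    gives an inflection point.  For uniqueness, [f''/f' = G - 2 D] with
    [G = (A p b - B a q) / (p b + a q)] and [D = (p - q) / (a + b)].
    As [m''/m'] decreases and [m(0) = m'(0) = 0], each [m] is log-concave, so
    [p/a] decreases and [q/b] increases in [s]; together with the monotonicity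
    of [A] and [B] this makes [G] strictly decreasing.  At a zero of [f'']
    the equation [G = 2 D] forces [D' > 0].  Hence [f''/f'] crosses zero
    strictly downwards at each of its zeros, so it has at most one.  This avoids
    third derivatives, which need not exist. *)
Require Import Defs.
From Stdlib Require Import Reals Lra Psatz.
From Coquelicot Require Import Coquelicot.
Open Scope R_scope.

(** * Real analysis: mean value theorem, local signs, zeros crossed downwards *)

(** Cauchy's mean value theorem with the identity as second function. Derivatives are asked for only
    inside the interval, because the extended functions below are differentiated only on (0,1). *)
Lemma mean_value_open (f df : R -> R) (a b : R) :
  a < b ->
  (forall x, a <= x <= b -> continuous f x) ->
  (forall x, a < x < b -> is_derive f x (df x)) ->
  exists c, a < c < b /\ f b - f a = df c * (b - a).
Proof.
  intros Hab Hc Hd.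
  assert (pr1 : forall c, a < c < b -> derivable_pt f c).
  { intros c Hcab. exists (df c). apply is_derive_Reals, Hd, Hcab. }
  assert (pr2 : forall c, a < c < b -> derivable_pt id c).
  { intros c _. apply derivable_pt_id. }
  destruct (MVT f id a b pr1 pr2 Hab) as [c [Pc Hmvt]].
  - intros c Hcab. apply continuity_pt_filterlim, Hc, Hcab.
  - intros c _. apply derivable_continuous_pt, derivable_pt_id.
  - exists c. split; [exact Pc|].
    rewrite (derive_pt_eq_0 f c (df c) (pr1 c Pc)) in Hmvt
      by (apply is_derive_Reals, Hd, Pc).
    rewrite (derive_pt_eq_0 id c 1 (pr2 c Pc)) in Hmvt
      by apply derivable_pt_lim_id.
    unfold id in Hmvt. lra.
Qed.

(** With tolerance [l] the difference quotient stays positive near [x]. Only comparisons with the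
    value at [x] follow, since the derivative is known at that single point. *)
Lemma is_derive_pos_locally_increasing (f : R -> R) (x l : R) :
  is_derive f x l -> 0 < l ->
  exists d : posreal, forall y, Rabs (y - x) < d ->
    (x < y -> f x < f y) /\ (y < x -> f y < f x).
Proof.
  intros Hd Hl. apply is_derive_Reals in Hd.
  destruct (Hd l Hl) as [d H]. exists d. intros y Hy.
  assert (Hne : y <> x -> 0 < (f y - f x) / (y - x)).
  { intros Hyx. specialize (H (y - x)).
    replace (x + (y - x)) with y in H by ring.
    assert (H0 : y - x <> 0) by lra.
    specialize (H H0 Hy). apply Rabs_def2 in H. lra. }
  split; intros Hlt.
  - assert (Hq : f y - f x = (f y - f x) / (y - x) * (y - x)) by (field; lra).
    specialize (Hne ltac:(lra)). nra.
  - assert (Hq : f y - f x = (f y - f x) / (y - x) * (y - x)) by (field; lra).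
    specialize (Hne ltac:(lra)). nra.
Qed.

Lemma continuous_pos_locally (h : R -> R) (x : R) :
  continuous h x -> 0 < h x ->
  exists d : posreal, forall y, Rabs (y - x) < d -> 0 < h y.
Proof.
  intros Hc Hx.
  destruct (Hc (fun z => 0 < z)) as [d Hd].
  - exists (mkposreal _ Hx). intros z Hz.
    change (Rabs (z - h x) < h x) in Hz. apply Rabs_def2 in Hz. lra.
  - exists d. intros y Hy. apply Hd, Hy.
Qed.

(** Just after [s] the function is negative; let [c] be the supremum of the points of [[s,t)] where
    it is negative. Each sign of [h c] contradicts the choice of [c]: if negative, then [c < t] and
    [h] stays negative to the right; if positive, [h] is positive to the left; if zero, the crossing
    makes [h] negative to the right when [c < t] and positive to the left when [c = t]. *)
Lemma downcrossing_zero_unique (h : R -> R) (a b s t : R) :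
  (forall x, a < x < b -> continuous h x) ->
  (forall x, a < x < b -> h x = 0 ->
    exists d : posreal, forall y, Rabs (y - x) < d -> a < y < b ->
      (x < y -> h y < 0) /\ (y < x -> 0 < h y)) ->
  a < s -> s < t -> t < b -> h s = 0 -> h t = 0 -> False.
Proof.
  intros Hc Hz Has Hst Htb Hs Ht.
  set (E := fun x => s <= x < t /\ h x < 0).
  assert (Hne : exists x, E x).
  { destruct (Hz s ltac:(lra) Hs) as [d Hd].
    pose proof (cond_pos d) as Hdp.
    exists (s + Rmin (d / 2) ((t - s) / 2)).
    pose proof (Rmin_l (d / 2) ((t - s) / 2)).
    pose proof (Rmin_r (d / 2) ((t - s) / 2)).
    assert (0 < Rmin (d / 2) ((t - s) / 2)) by (apply Rmin_pos; lra).
    split; [lra|]. apply Hd; [|lra|lra].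
    rewrite Rabs_pos_eq; lra. }
  destruct (completeness E) as [c [Hub Hlub]].
  { exists t. intros x [Hx _]. lra. }
  { exact Hne. }
  assert (Hsc : s <= c).
  { destruct Hne as [x Hx]. pose proof (Hub x Hx). destruct Hx. lra. }
  assert (Hct : c <= t).
  { apply Hlub. intros x [Hx _]. lra. }
  (* If [h] were nonnegative on a left neighbourhood of [c], then [c - d] would be a smaller upper
     bound of [E]. *)
  assert (Hleft : forall d : posreal,
    (forall y, Rabs (y - c) < d -> a < y < b -> y <= c -> 0 <= h y) -> False).
  { intros d Hd. pose proof (cond_pos d) as Hdp.
    assert (c <= c - d); [|lra].
    apply Hlub. intros x Hx. pose proof (Hub x Hx). destruct Hx as [Hx Hhx].
    destruct (Rle_dec x (c - d)) as [|Hn]; [assumption|].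
    exfalso. specialize (Hd x). assert (0 <= h x); [|lra].
    apply Hd; try lra. rewrite Rabs_left1; lra. }
  (* If [h] were negative just to the right of [c], then [E] would contain points beyond its upper
     bound. *)
  assert (Hright : forall d : posreal, c < t ->
    (forall y, Rabs (y - c) < d -> a < y < b -> c < y -> h y < 0) -> False).
  { intros d Hlt Hd. pose proof (cond_pos d) as Hdp.
    pose proof (Rmin_l (d / 2) ((t - c) / 2)).
    pose proof (Rmin_r (d / 2) ((t - c) / 2)).
    assert (0 < Rmin (d / 2) ((t - c) / 2)) by (apply Rmin_pos; lra).
    set (y := c + Rmin (d / 2) ((t - c) / 2)).
    assert (y <= c); [|unfold y in *; lra].
    apply Hub. split; [unfold y; lra|].
    apply Hd; unfold y; try lra. rewrite Rabs_pos_eq; lra. }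
  destruct (Rtotal_order (h c) 0) as [Hneg | [Hzero | Hpos]].
  - destruct (continuous_pos_locally (fun x => - h x) c) as [d Hd].
    + apply (continuous_opp h), Hc. lra.
    + lra.
    + apply (Hright d).
      * destruct (Req_dec c t) as [E1|]; [rewrite E1 in Hneg; lra | lra].
      * intros y Hy _ _. specialize (Hd y Hy). simpl in Hd. lra.
  - destruct (Hz c ltac:(lra) Hzero) as [d Hd].
    destruct (Req_dec c t) as [E1|].
    + apply (Hleft d). intros y Hy Hy1 Hy2.
      destruct (Req_dec y c) as [->|]; [lra|].
      apply Rlt_le, Hd; lra.
    + apply (Hright d); [lra|]. intros y Hy Hy1 Hy2. apply Hd; lra.
  - destruct (continuous_pos_locally h c) as [d Hd]; [apply Hc; lra | lra |].
    apply (Hleft d). intros y Hy _ _. apply Rlt_le, Hd, Hy.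
Qed.

(** * Extension of the class to the whole line, and log-concavity *)

(** The nearest-point projection onto [0,1]. It fixes [0,1] and is 1-Lipschitz, so composing with it
    turns continuity relative to [I01] into two-sided continuity. *)
Definition clamp (x : R) : R := Rmax 0 (Rmin 1 x).

Lemma clamp_I01 (x : R) : I01 (clamp x).
Proof.
  unfold I01, clamp, Rmax, Rmin.
  destruct (Rle_dec 1 x); destruct (Rle_dec 0 _); lra.
Qed.

Lemma clamp_id (x : R) : I01 x -> clamp x = x.
Proof.
  unfold I01, clamp, Rmax, Rmin. intros H.
  destruct (Rle_dec 1 x); destruct (Rle_dec 0 _); lra.
Qed.

Lemma clamp_dist (x y : R) : Rabs (clamp x - clamp y) <= Rabs (x - y).
Proof.
  unfold clamp, Rmax, Rmin, Rabs.
  repeat destruct Rle_dec; repeat destruct Rcase_abs; lra.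
Qed.

Lemma locally_open01 (s : R) : 0 < s < 1 -> locally s (fun y => 0 < y < 1).
Proof.
  intros H.
  assert (Hd : 0 < Rmin s (1 - s)) by (apply Rmin_pos; lra).
  exists (mkposreal _ Hd). intros y Hy.
  change (Rabs (y - s) < Rmin s (1 - s)) in Hy.
  pose proof (Rmin_l s (1 - s)). pose proof (Rmin_r s (1 - s)).
  apply Rabs_def2 in Hy. lra.
Qed.

Lemma locally_I01 (s : R) : 0 < s < 1 -> locally s I01.
Proof.
  intros H. apply filter_imp with (2 := locally_open01 s H).
  intros y Hy. unfold I01. lra.
Qed.

Lemma continue_in_clamp (g : R -> R) (s : R) :
  I01 s -> continue_in g I01 s -> continuous (fun x => g (clamp x)) s.
Proof.
  intros Hs Hc. apply continuity_pt_filterlim.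
  intros eps Heps. destruct (Hc eps Heps) as [d [Hd H]].
  exists d. split; [exact Hd|]. intros x [_ Hx].
  rewrite (clamp_id s Hs).
  (* The relative limit ignores the point [s] itself, while at an endpoint [clamp x = s] also
     happens for [x <> s]. *)
  destruct (Req_dec (clamp x) s) as [E|E].
  - rewrite E. simpl. unfold Rdist. rewrite Rminus_diag, Rabs_R0. exact Heps.
  - apply H. split.
    + split; [apply clamp_I01|]. intros E1; apply E; now rewrite E1.
    + simpl in *. unfold Rdist in *.
      rewrite <- (clamp_id s Hs).
      apply Rle_lt_trans with (2 := Hx). apply clamp_dist.
Qed.

(** Near an interior point [clamp] is the identity. At 0 and 1 a constant extension need not be
    differentiable. *)
Lemma D_in_clamp (g g1 : R -> R) (s : R) :
  0 < s < 1 -> D_in g g1 I01 s -> is_derive (fun x => g (clamp x)) s (g1 s).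
Proof.
  intros Hs HD. apply is_derive_ext_loc with g.
  { apply filter_imp with (2 := locally_I01 s Hs).
    intros y Hy. now rewrite clamp_id. }
  apply is_derive_Reals. intros eps Heps.
  destruct (HD eps Heps) as [d [Hd H]].
  destruct (locally_I01 s Hs) as [d' Hd'].
  assert (Hm : 0 < Rmin d d') by (apply Rmin_pos; [exact Hd | apply cond_pos]).
  exists (mkposreal _ Hm). intros k Hk0 Hk. simpl in Hk.
  pose proof (Rmin_l d d'). pose proof (Rmin_r d d').
  specialize (H (s + k)). simpl in H. unfold Rdist in H.
  replace (s + k - s) with k in H by ring.
  apply H. split; [|lra]. split; [|lra].
  apply Hd'. change (Rabs (s + k - s) < d').
  replace (s + k - s) with k by ring. lra.
Qed.

(* A member of the class extended to the whole line by constants, so that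
   continuity at 0 and 1 is two-sided. *)
Record extended_M (m m1 m2 : R -> R) : Prop := {
  ext_cont : forall s, 0 <= s <= 1 -> continuous m s;
  ext_cont1 : forall s, 0 <= s <= 1 -> continuous m1 s;
  ext_cont2 : forall s, 0 <= s <= 1 -> continuous m2 s;
  ext_der : forall s, 0 < s < 1 -> is_derive m s (m1 s);
  ext_der1 : forall s, 0 < s < 1 -> is_derive m1 s (m2 s);
  ext_pos : forall s, 0 < s <= 1 -> 0 < m s;
  ext_pos1 : forall s, 0 < s <= 1 -> 0 < m1 s;
  ext_pos2 : forall s, 0 < s <= 1 -> 0 < m2 s;
  ext_zero : m 0 = 0;
  ext_zero1 : m1 0 = 0;
  ext_decr : forall s t, 0 < s -> s < t -> t < 1 -> m2 t / m1 t < m2 s / m1 s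
}.

Lemma class_M_extended (m : R -> R) :
  class_M m ->
  exists M M1 M2, (forall s, I01 s -> M s = m s) /\ extended_M M M1 M2.
Proof.
  intros (m1 & m2 & HC & (Hp & H0) & (Hp1 & H01) & Hp2 & Hdecr).
  exists (fun x => m (clamp x)), (fun x => m1 (clamp x)),
    (fun x => m2 (clamp x)).
  assert (Hid : forall s, 0 <= s <= 1 -> clamp s = s)
    by (intros s Hs; apply clamp_id, Hs).
  split; [intros s Hs; now rewrite clamp_id|].
  split; simpl.
  - intros s Hs. destruct (HC s Hs) as (D1 & _ & _).
    apply continue_in_clamp; [exact Hs|]. exact (cont_deriv _ _ _ _ D1).
  - intros s Hs. destruct (HC s Hs) as (_ & D2 & _).
    apply continue_in_clamp; [exact Hs|]. exact (cont_deriv _ _ _ _ D2).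
  - intros s Hs. destruct (HC s Hs) as (_ & _ & C).
    now apply continue_in_clamp.
  - intros s Hs. rewrite Hid by lra.
    apply D_in_clamp; [exact Hs|]. apply HC. unfold I01. lra.
  - intros s Hs. rewrite Hid by lra.
    apply D_in_clamp; [exact Hs|]. apply HC. unfold I01. lra.
  - intros s Hs. rewrite Hid by lra. auto.
  - intros s Hs. rewrite Hid by lra. auto.
  - intros s Hs. rewrite Hid by lra. auto.
  - rewrite Hid by lra. auto.
  - rewrite Hid by lra. auto.
  - intros s t Hs Hst Ht. rewrite !Hid by lra. auto.
Qed.

(* Mean value theorem on [0, s] for [m1 - k m] with [k = m2 s / m1 s]: its
   derivative is [m1 (m2 / m1 - k)]. *)
Lemma extended_M_log_concave (m m1 m2 : R -> R) (s : R) :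
  extended_M m m1 m2 -> 0 < s < 1 -> m2 s * m s < m1 s * m1 s.
Proof.
  intros H Hs. set (k := m2 s / m1 s).
  destruct (mean_value_open (fun t => m1 t - k * m t)
    (fun t => m2 t - k * m1 t) 0 s) as [c [Hc E]].
  - lra.
  - intros x Hx. apply (continuous_minus m1 (fun t => k * m t)).
    + apply (ext_cont1 _ _ _ H). lra.
    + apply (continuous_scal_r k m), (ext_cont _ _ _ H). lra.
  - intros x Hx. apply (is_derive_minus m1 (fun t => k * m t)).
    + apply (ext_der1 _ _ _ H). lra.
    + apply is_derive_scal, (ext_der _ _ _ H). lra.
  - rewrite (ext_zero _ _ _ H), (ext_zero1 _ _ _ H) in E.
    pose proof (ext_pos1 _ _ _ H s ltac:(lra)) as P1.
    pose proof (ext_pos1 _ _ _ H c ltac:(lra)) as Pc.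
    pose proof (ext_decr _ _ _ H c s ltac:(lra) ltac:(lra) ltac:(lra)) as Hd.
    fold k in Hd.
    assert (Ec : m2 c = m2 c / m1 c * m1 c) by (field; lra).
    assert (Es : m2 s = k * m1 s) by (unfold k; field; lra).
    assert (0 < m2 c - k * m1 c) by nra.
    assert (0 < m1 s - k * m s) by nra.
    rewrite Es. nra.
Qed.

(** Log-concavity makes the derivative [(m2 m - m1 m1) / m^2] of the quotient negative. *)
Lemma extended_M_log_derivative_decr (m m1 m2 : R -> R) (s t : R) :
  extended_M m m1 m2 -> 0 < s -> s < t -> t < 1 -> m1 t / m t < m1 s / m s.
Proof.
  intros H Hs Hst Ht.
  assert (Hd : forall x, s <= x <= t -> is_derive (fun x => m1 x / m x) x
    ((m2 x * m x - m1 x * m1 x) / (m x) ^ 2)).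
  { intros x Hx. pose proof (ext_pos _ _ _ H x ltac:(lra)).
    apply (is_derive_div m1 m).
    - apply (ext_der1 _ _ _ H). lra.
    - apply (ext_der _ _ _ H). lra.
    - lra. }
  destruct (mean_value_open (fun x => m1 x / m x)
    (fun x => (m2 x * m x - m1 x * m1 x) / (m x) ^ 2) s t Hst) as [c [Hc E]].
  - intros x Hx. apply (ex_derive_continuous (fun x => m1 x / m x)).
    eexists. apply Hd, Hx.
  - intros x Hx. apply Hd. lra.
  - pose proof (extended_M_log_concave _ _ _ c H ltac:(lra)).
    pose proof (ext_pos _ _ _ H c ltac:(lra)).
    assert (0 < / m c ^ 2) by (apply Rinv_0_lt_compat; nra).
    assert ((m2 c * m c - m1 c * m1 c) / m c ^ 2 < 0) by (unfold Rdiv; nra).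
    nra.
Qed.

(** * Reflection, quotients, and the two inequalities behind uniqueness *)

Lemma is_derive_reflect (g g1 : R -> R) (s : R) :
  is_derive g (1 - s) (g1 (1 - s)) ->
  is_derive (fun x => g (1 - x)) s (- g1 (1 - s)).
Proof.
  intros H.
  replace (- g1 (1 - s)) with (scal (-1) (g1 (1 - s)))
    by (unfold scal; simpl; unfold mult; simpl; ring).
  apply (is_derive_comp g (fun x => 1 - x)); [exact H|].
  auto_derive; [trivial | ring].
Qed.

Lemma continuous_reflect (g : R -> R) (s : R) :
  continuous g (1 - s) -> continuous (fun x => g (1 - x)) s.
Proof.
  intros H. apply (continuous_comp (fun x => 1 - x) g); [|exact H].
  apply (continuous_minus (fun _ => 1) (fun x => x));
    [apply continuous_const | apply continuous_id].
Qed.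

Lemma continuous_Rdiv (g k : R -> R) (s : R) :
  continuous g s -> continuous k s -> k s <> 0 ->
  continuous (fun x => g x / k x) s.
Proof.
  intros Hg Hk H0. apply (continuous_mult g (fun x => / k x)); [exact Hg|].
  now apply continuous_Rinv_comp.
Qed.

(** Each side is the mean of [A] and [-B] with weights [P] and [Q]. From index 1 to index 2 both
    values fall, and weight moves from the larger value [A] to the smaller [-B]. After
    cross-multiplication the difference splits into the four positive pieces asserted below. *)
Lemma weighted_mean_decr (A1 A2 B1 B2 P1 P2 Q1 Q2 : R) :
  0 < A2 < A1 -> 0 < B1 < B2 -> 0 < P2 < P1 -> 0 < Q1 < Q2 ->
  (A2 * P2 - B2 * Q2) / (P2 + Q2) < (A1 * P1 - B1 * Q1) / (P1 + Q1).
Proof.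
  intros HA HB HP HQ.
  apply Rmult_lt_reg_r with ((P1 + Q1) * (P2 + Q2)); [nra|].
  replace ((A2 * P2 - B2 * Q2) / (P2 + Q2) * ((P1 + Q1) * (P2 + Q2)))
    with ((A2 * P2 - B2 * Q2) * (P1 + Q1)) by (field; lra).
  replace ((A1 * P1 - B1 * Q1) / (P1 + Q1) * ((P1 + Q1) * (P2 + Q2)))
    with ((A1 * P1 - B1 * Q1) * (P2 + Q2)) by (field; lra).
  assert (0 < (A1 - A2) * (P1 * P2))
    by (repeat apply Rmult_lt_0_compat; lra).
  assert (0 < (B2 - B1) * (Q1 * Q2))
    by (repeat apply Rmult_lt_0_compat; lra).
  assert (A2 * (P2 * Q1) < A1 * (P1 * Q2)).
  { apply Rmult_gt_0_lt_compat; try nra. }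
  assert (B1 * (Q1 * P2) < B2 * (Q2 * P1)).
  { apply Rmult_gt_0_lt_compat; try nra. }
  nra.
Qed.

(** Here [u] and [r] stand for the second derivatives, the equation says that the numerator of [f'']
    vanishes, and the conclusion is positivity of the numerator of [D']. If [p > q], dropping
    positive terms from the equation and dividing by [b] gives [2 p (p - q) <= u (a + b)], and
    [2 p > p - q]. The case [p < q] is symmetric, with [r] and [a]. *)
Lemma critical_slope_gap_bound (a b p q u r : R) :
  0 < a -> 0 < b -> 0 < p -> 0 < q -> 0 < u -> 0 < r ->
  (u * b - a * r) * (a + b) = 2 * (p * b + a * q) * (p - q) ->
  (p - q) * (p - q) < (u + r) * (a + b).
Proof.
  intros Ha Hb Hp Hq Hu Hr E.
  assert (0 < u * (a + b)) by nra.
  assert (0 < r * (a + b)) by nra.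
  assert (0 < a * q) by nra. assert (0 < p * b) by nra.
  destruct (Rtotal_order p q) as [Hlt | [-> | Hgt]].
  - assert (2 * q * (q - p) <= r * (a + b)).
    { apply Rmult_le_reg_l with a; [lra|].
      assert (0 < u * b * (a + b)) by nra.
      assert (0 < p * b * (q - p)) by nra. nra. }
    nra.
  - nra.
  - assert (2 * p * (p - q) <= u * (a + b)).
    { apply Rmult_le_reg_l with b; [lra|].
      assert (0 < a * r * (a + b)) by nra.
      assert (0 < a * q * (p - q)) by nra. nra. }
    nra.
Qed.

(** * Derivatives and continuity of the fractional flow *)

Section FractionalFlow.

Context (ma a1 a2 mb b1 b2 : R -> R).
Context (HA : extended_M ma a1 a2) (HB : extended_M mb b1 b2).

Let f := fractional_flow ma mb.

Definition flow_slope (x : R) : R :=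
  (a1 x * mb (1 - x) + ma x * b1 (1 - x)) / (ma x + mb (1 - x)) ^ 2.

(** This is [f''] multiplied by the cube of the denominator of [f]. *)
Definition flow_curvature_num (x : R) : R :=
  (a2 x * mb (1 - x) - ma x * b2 (1 - x)) * (ma x + mb (1 - x))
  - 2 * (a1 x * mb (1 - x) + ma x * b1 (1 - x)) * (a1 x - b1 (1 - x)).

(** The logarithmic derivative of the numerator of [flow_slope]: the cross terms [a1 x * b1 (1 - x)]
    cancel because of the reflection. *)
Definition flow_G (x : R) : R :=
  (a2 x * mb (1 - x) - ma x * b2 (1 - x))
  / (a1 x * mb (1 - x) + ma x * b1 (1 - x)).

(** The logarithmic derivative of the denominator of [f]; it enters twice because [flow_slope] has
    that denominator squared. *)
Definition flow_D (x : R) : R :=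
  (a1 x - b1 (1 - x)) / (ma x + mb (1 - x)).

Lemma flow_positivity (s : R) : 0 < s < 1 ->
  (0 < ma s /\ 0 < a1 s /\ 0 < a2 s) /\
  (0 < mb (1 - s) /\ 0 < b1 (1 - s) /\ 0 < b2 (1 - s)).
Proof.
  intros Hs. repeat split.
  - apply (ext_pos _ _ _ HA). lra.
  - apply (ext_pos1 _ _ _ HA). lra.
  - apply (ext_pos2 _ _ _ HA). lra.
  - apply (ext_pos _ _ _ HB). lra.
  - apply (ext_pos1 _ _ _ HB). lra.
  - apply (ext_pos2 _ _ _ HB). lra.
Qed.

(** At each endpoint one summand vanishes and the other is a positive value at 1. *)
Lemma flow_denominator_pos (s : R) : 0 <= s <= 1 -> 0 < ma s + mb (1 - s).
Proof.
  intros Hs. destruct (Req_dec s 0) as [->|].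
  - rewrite (ext_zero _ _ _ HA).
    pose proof (ext_pos _ _ _ HB (1 - 0) ltac:(lra)). lra.
  - pose proof (ext_pos _ _ _ HA s ltac:(lra)).
    destruct (Req_dec s 1) as [->|].
    + rewrite Rminus_diag, (ext_zero _ _ _ HB). lra.
    + pose proof (ext_pos _ _ _ HB (1 - s) ltac:(lra)). lra.
Qed.

Lemma flow_derivatives (s : R) : 0 < s < 1 ->
  is_derive ma s (a1 s) /\ is_derive a1 s (a2 s) /\
  is_derive (fun x => mb (1 - x)) s (- b1 (1 - s)) /\
  is_derive (fun x => b1 (1 - x)) s (- b2 (1 - s)).
Proof.
  intros Hs. refine (conj _ (conj _ (conj _ _))).
  - apply (ext_der _ _ _ HA), Hs.
  - apply (ext_der1 _ _ _ HA), Hs.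
  - apply is_derive_reflect, (ext_der _ _ _ HB). lra.
  - apply is_derive_reflect, (ext_der1 _ _ _ HB). lra.
Qed.

Lemma flow_is_derive (s : R) : 0 < s < 1 -> is_derive f s (flow_slope s).
Proof.
  intros Hs. destruct (flow_derivatives s Hs) as (Da & _ & Db & _).
  pose proof (flow_denominator_pos s ltac:(lra)) as Hp.
  unfold f, fractional_flow, flow_slope.
  evar_last.
  - apply (is_derive_div ma (fun x => ma x + mb (1 - x))); [exact Da| |lra].
    apply (is_derive_plus ma (fun x => mb (1 - x))); [exact Da|exact Db].
  - unfold plus; simpl. field. lra.
Qed.

Lemma flow_slope_is_derive (s : R) : 0 < s < 1 ->
  is_derive flow_slope s (flow_curvature_num s / (ma s + mb (1 - s)) ^ 3).
Proof.
  intros Hs. destruct (flow_derivatives s Hs) as (Da & Da1 & Db & Db1).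
  pose proof (flow_denominator_pos s ltac:(lra)) as Hp.
  unfold flow_slope, flow_curvature_num.
  evar_last.
  - apply (is_derive_div
      (fun x => a1 x * mb (1 - x) + ma x * b1 (1 - x))
      (fun x => (ma x + mb (1 - x)) ^ 2)).
    + apply (is_derive_plus (fun x => a1 x * mb (1 - x))
        (fun x => ma x * b1 (1 - x))).
      * apply (is_derive_mult a1 (fun x => mb (1 - x)));
          [exact Da1 | exact Db | apply Rmult_comm].
      * apply (is_derive_mult ma (fun x => b1 (1 - x)));
          [exact Da | exact Db1 | apply Rmult_comm].
    + apply (is_derive_pow (fun x => ma x + mb (1 - x))).
      apply (is_derive_plus ma (fun x => mb (1 - x))); [exact Da|exact Db].
    + apply pow_nonzero. lra.
  - unfold plus, mult; simpl. unfold mult; simpl. field. lra.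
Qed.

Lemma flow_D_is_derive (s : R) : 0 < s < 1 ->
  is_derive flow_D s
    (((a2 s + b2 (1 - s)) * (ma s + mb (1 - s))
      - (a1 s - b1 (1 - s)) * (a1 s - b1 (1 - s))) / (ma s + mb (1 - s)) ^ 2).
Proof.
  intros Hs. destruct (flow_derivatives s Hs) as (Da & Da1 & Db & Db1).
  pose proof (flow_denominator_pos s ltac:(lra)) as Hp.
  unfold flow_D.
  evar_last.
  - apply (is_derive_div (fun x => a1 x - b1 (1 - x))
      (fun x => ma x + mb (1 - x))).
    + apply (is_derive_minus a1 (fun x => b1 (1 - x))); [exact Da1|exact Db1].
    + apply (is_derive_plus ma (fun x => mb (1 - x))); [exact Da|exact Db].
    + lra.
  - unfold minus, plus, opp; simpl. field. lra.
Qed.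

Lemma flow_continuity (s : R) : 0 <= s <= 1 ->
  (continuous ma s /\ continuous a1 s /\ continuous a2 s) /\
  (continuous (fun x => mb (1 - x)) s /\ continuous (fun x => b1 (1 - x)) s
   /\ continuous (fun x => b2 (1 - x)) s).
Proof.
  intros Hs. refine (conj (conj _ (conj _ _)) (conj _ (conj _ _))).
  - apply (ext_cont _ _ _ HA), Hs.
  - apply (ext_cont1 _ _ _ HA), Hs.
  - apply (ext_cont2 _ _ _ HA), Hs.
  - apply continuous_reflect, (ext_cont _ _ _ HB). lra.
  - apply continuous_reflect, (ext_cont1 _ _ _ HB). lra.
  - apply continuous_reflect, (ext_cont2 _ _ _ HB). lra.
Qed.

Lemma flow_slope_continuous (s : R) : 0 <= s <= 1 -> continuous flow_slope s.
Proof.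
  intros Hs. destruct (flow_continuity s Hs) as ((Ca & Ca1 & _) & Cb & Cb1 & _).
  pose proof (flow_denominator_pos s Hs) as Hp.
  apply (continuous_mult
    (fun x => a1 x * mb (1 - x) + ma x * b1 (1 - x))
    (fun x => / (ma x + mb (1 - x)) ^ 2)).
  - apply (continuous_plus (fun x => a1 x * mb (1 - x))
      (fun x => ma x * b1 (1 - x))).
    + now apply (continuous_mult a1 (fun x => mb (1 - x))).
    + now apply (continuous_mult ma (fun x => b1 (1 - x))).
  - apply (continuous_comp (fun x => ma x + mb (1 - x)) (fun y => / y ^ 2)).
    + now apply (continuous_plus ma (fun x => mb (1 - x))).
    + apply (ex_derive_continuous (fun y => / y ^ 2)). auto_derive. nra.
Qed.

Lemma flow_G_continuous (s : R) : 0 < s < 1 -> continuous flow_G s.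
Proof.
  intros Hs.
  destruct (flow_continuity s ltac:(lra))
    as ((Ca & Ca1 & Ca2) & Cb & Cb1 & Cb2).
  destruct (flow_positivity s Hs) as ((Pa & Pa1 & _) & Pb & Pb1 & _).
  apply (continuous_Rdiv
    (fun x => a2 x * mb (1 - x) - ma x * b2 (1 - x))
    (fun x => a1 x * mb (1 - x) + ma x * b1 (1 - x))).
  - apply (continuous_minus (fun x => a2 x * mb (1 - x))
      (fun x => ma x * b2 (1 - x))).
    + now apply (continuous_mult a2 (fun x => mb (1 - x))).
    + now apply (continuous_mult ma (fun x => b2 (1 - x))).
  - apply (continuous_plus (fun x => a1 x * mb (1 - x))
      (fun x => ma x * b1 (1 - x))).
    + now apply (continuous_mult a1 (fun x => mb (1 - x))).
    + now apply (continuous_mult ma (fun x => b1 (1 - x))).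
  - nra.
Qed.

(** * Uniqueness and existence of the zero of the second derivative *)

Lemma flow_G_decr (s t : R) : 0 < s -> s < t -> t < 1 -> flow_G t < flow_G s.
Proof.
  intros Hs Hst Ht.
  (* Dividing numerator and denominator by [ma x * mb (1 - x)] exhibits a weighted mean whose values
     and weights are monotone; the reflection reverses the monotonicity of those built from [mb]. *)
  assert (E : forall x, 0 < x < 1 -> flow_G x =
    (a2 x / a1 x * (a1 x / ma x)
      - b2 (1 - x) / b1 (1 - x) * (b1 (1 - x) / mb (1 - x)))
    / (a1 x / ma x + b1 (1 - x) / mb (1 - x))).
  { intros x Hx.
    destruct (flow_positivity x Hx) as ((Pa & Pa1 & _) & Pb & Pb1 & _).
    unfold flow_G. field. repeat split; try lra; nra. }
  rewrite !E by lra.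
  destruct (flow_positivity s ltac:(lra)) as ((Pa & Pa1 & Pa2) & Pb & Pb1 & Pb2).
  destruct (flow_positivity t ltac:(lra)) as ((Qa & Qa1 & Qa2) & Qb & Qb1 & Qb2).
  apply weighted_mean_decr; split; try (apply Rdiv_lt_0_compat; assumption).
  - apply (ext_decr _ _ _ HA); lra.
  - apply (ext_decr _ _ _ HB); lra.
  - apply (extended_M_log_derivative_decr _ _ _ _ _ HA); lra.
  - apply (extended_M_log_derivative_decr _ _ _ _ _ HB); lra.
Qed.

Lemma flow_curvature_num_factor (s : R) : 0 < s < 1 ->
  flow_curvature_num s =
  (flow_G s - 2 * flow_D s)
  * ((a1 s * mb (1 - s) + ma s * b1 (1 - s)) * (ma s + mb (1 - s))).
Proof.
  intros Hs.
  destruct (flow_positivity s Hs) as ((Pa & Pa1 & Pa2) & Pb & Pb1 & Pb2).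
  unfold flow_curvature_num, flow_G, flow_D. field. split; nra.
Qed.

Lemma flow_curvature_num_zero_unique (s t : R) :
  0 < s -> s < t -> t < 1 ->
  flow_curvature_num s = 0 -> flow_curvature_num t = 0 -> False.
Proof.
  intros Hs Hst Ht Es Et.
  assert (Hfac : forall x, 0 < x < 1 -> flow_curvature_num x = 0 ->
    flow_G x - 2 * flow_D x = 0).
  { intros x Hx E. rewrite flow_curvature_num_factor in E by exact Hx.
    destruct (flow_positivity x Hx) as ((Pa & Pa1 & _) & Pb & Pb1 & _).
    apply Rmult_integral in E as [E|E]; [exact E|].
    assert (0 < (a1 x * mb (1 - x) + ma x * b1 (1 - x)) * (ma x + mb (1 - x)))
      by (apply Rmult_lt_0_compat; nra).
    lra. }
  apply (downcrossing_zero_unique (fun x => flow_G x - 2 * flow_D x) 0 1 s t);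
    try lra; try (apply Hfac; [lra | assumption]).
  - intros x Hx. apply (continuous_minus flow_G (fun x => 2 * flow_D x)).
    + apply flow_G_continuous, Hx.
    + apply (continuous_scal_r 2 flow_D).
      apply (ex_derive_continuous flow_D). eexists. apply flow_D_is_derive, Hx.
  - intros x Hx E0.
    destruct (flow_positivity x Hx) as ((Pa & Pa1 & Pa2) & Pb & Pb1 & Pb2).
    destruct (is_derive_pos_locally_increasing _ _ _ (flow_D_is_derive x Hx))
      as [d Hd].
    + apply Rdiv_lt_0_compat; [|nra].
      apply Rlt_0_minus, critical_slope_gap_bound; try assumption.
      (* Multiplying [E0] by the factor turns it into the equation required by the bound. *)
      pose proof (flow_curvature_num_factor x Hx) as E.
      rewrite E0, Rmult_0_l in E. unfold flow_curvature_num in E. lra.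
    (* [flow_G] falls strictly and [flow_D] rises through its value at [x], so the difference
       crosses zero downwards. *)
    + exists d. intros y Hy Hy01. specialize (Hd y Hy). split; intros Hlt.
      * pose proof (flow_G_decr x y ltac:(lra) Hlt ltac:(lra)).
        pose proof (proj1 Hd Hlt). lra.
      * pose proof (flow_G_decr y x ltac:(lra) Hlt ltac:(lra)).
        pose proof (proj2 Hd Hlt). lra.
Qed.

Lemma flow_curvature_num_zero_exists :
  exists s, 0 < s < 1 /\ flow_curvature_num s = 0.
Proof.
  destruct (mean_value_open flow_slope
    (fun s => flow_curvature_num s / (ma s + mb (1 - s)) ^ 3) 0 1)
    as [c [Hc E]].
  - lra.
  - apply flow_slope_continuous.
  - apply flow_slope_is_derive.
  - exists c. split; [exact Hc|].
    unfold flow_slope in E.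
    (* Each summand of the slope numerator contains [ma 0] or [a1 0] at the left end, and [mb 0] or
       [b1 0] at the right end. *)
    rewrite Rminus_diag, (ext_zero _ _ _ HA), (ext_zero1 _ _ _ HA),
      (ext_zero _ _ _ HB), (ext_zero1 _ _ _ HB) in E.
    pose proof (flow_denominator_pos c ltac:(lra)) as Hp.
    assert (E1 : flow_curvature_num c / (ma c + mb (1 - c)) ^ 3 = 0).
    { unfold Rdiv in *. rewrite ?Rmult_0_l, ?Rmult_0_r, ?Rplus_0_l,
        ?Rmult_0_l in E. lra. }
    apply Rmult_integral in E1 as [E1|E1]; [exact E1|].
    exfalso. revert E1. apply Rinv_neq_0_compat, pow_nonzero. lra.
Qed.

(** * From zeros of the curvature to inflection points of the original flow *)

(** The second derivative is taken of [Derive f], which is identified with [flow_slope] only on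
    (0,1); this open interval is a neighbourhood of [s], so local equality suffices. *)
Lemma flow_inflection_iff (s : R) : 0 < s < 1 ->
  is_derive_n f 2 s 0 <-> flow_curvature_num s = 0.
Proof.
  intros Hs. simpl.
  assert (Hloc : locally s (fun y => Derive (fun x => f x) y = flow_slope y)).
  { apply filter_imp with (2 := locally_open01 s Hs).
    intros y Hy. apply is_derive_unique, flow_is_derive, Hy. }
  pose proof (flow_slope_is_derive s Hs) as Hd.
  pose proof (flow_denominator_pos s ltac:(lra)) as Hp.
  split.
  - intros H. apply (is_derive_ext_loc _ flow_slope) in H; [|exact Hloc].
    pose proof (is_derive_unique _ _ _ H) as E.
    rewrite (is_derive_unique _ _ _ Hd) in E.
    apply Rmult_integral in E as [E|E]; [exact E|].
    exfalso. revert E. apply Rinv_neq_0_compat, pow_nonzero. lra.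
  - intros E. rewrite E in Hd. unfold Rdiv in Hd. rewrite Rmult_0_l in Hd.
    apply is_derive_ext_loc with (2 := Hd).
    apply filter_imp with (2 := Hloc). intros y Hy. now rewrite Hy.
Qed.

Lemma flow_S_shaped : S_shaped f.
Proof.
  destruct flow_curvature_num_zero_exists as [s [Hs Es]].
  exists s. split.
  - split; [exact Hs|]. now apply flow_inflection_iff.
  - intros t [Ht It]. apply flow_inflection_iff in It; [|exact Ht].
    destruct (Rtotal_order s t) as [Hlt | [E | Hlt]]; [|exact E|]; exfalso.
    + apply (flow_curvature_num_zero_unique s t); lra.
    + apply (flow_curvature_num_zero_unique t s); lra.
Qed.

End FractionalFlow.

(** Inflection is a local notion at interior points, so it passes between the flow of the extended
    functions and the original one, which agree on [0,1]. *)
Lemma inflection_point_ext (f g : R -> R) (s : R) :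
  (forall x, I01 x -> f x = g x) -> inflection_point f s -> inflection_point g s.
Proof.
  intros E [Hs H]. split; [exact Hs|].
  apply is_derive_n_ext_loc with (2 := H).
  apply filter_imp with (2 := locally_I01 s Hs). exact E.
Qed.

Theorem theorem1 (ma mb : R -> R) (Ha : class_M ma) (Hb : class_M mb) :
  S_shaped (fractional_flow ma mb).
Proof.
  destruct (class_M_extended ma Ha) as (Ma & Ma1 & Ma2 & Ea & HA).
  destruct (class_M_extended mb Hb) as (Mb & Mb1 & Mb2 & Eb & HB).
  assert (E : forall x, I01 x ->
    fractional_flow Ma Mb x = fractional_flow ma mb x).
  { intros x Hx. unfold fractional_flow.
    rewrite Ea, Eb by (unfold I01 in *; lra). reflexivity. }
  destruct (flow_S_shaped _ _ _ _ _ _ HA HB) as [s [Hs Hu]].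
  exists s. split.
  - exact (inflection_point_ext _ _ s E Hs).
  - intros t Ht. apply Hu. revert Ht. apply inflection_point_ext.
    intros x Hx. symmetry. now apply E.
Qed.
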